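(* Fix an integer $k\ge 2$. For each $n\in\mathbb{N}$, let $H_{k,n}$ be the number of subsets of $\{1,2,\ldots,n\}$ that (1) satisfy the $k$-Zeckendorf condition, (2) contain $n$, and (3) are weak-Schreier. Then $$H_{k,n}=\begin{cases}1, & \text{if } 1\le n\le k+1;\\ H_{k,n-1}+H_{k,n-(k+1)}, & \text{if } n>k+1.\end{cases}$$
   Context: $\mathbb{N}=\{1,2,3,\ldots\}$. A nonempty finite set $S\subseteq\mathbb{N}$ is weak-Schreier if $\min S\ge |S|$. A finite set of natural numbers satisfies the $k$-Zeckendorf condition if any two distinct numbers in the set are at least $k$ apart (singletons satisfy this vacuously). *)

(* Defs.v *)
From mathcomp Require Import all_boot ssrint finmap.
Set Implicit Arguments.
Unset Strict Implicit.
Unset Printing Implicit Defensive.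
Import IntDist.
Local Open Scope fset_scope.
Local Open Scope nat_scope.

(* Only meaningful for S nonempty: the default value [head 0 S] of the iterated
   minimum is then itself an element of S (see fset_minP). *)
Definition fset_min (S : {fset nat}) : nat := \big[minn/head 0 S]_(x <- S) x.

Lemma fset_minP (S : {fset nat}) :
  S != fset0 -> fset_min S \in S /\ (forall x, x \in S -> fset_min S <= x).
Proof.
move=> S0; have hS : head 0 S \in S.
  have [x] := fset0Pn _ S0.
  rewrite -[x \in S]/(x \in enum_fset S) -[head 0 S \in S]/(_ \in enum_fset S).
  by case: (enum_fset S) => //= a l _; exact: mem_head.
split; rewrite /fset_min.
  rewrite big_seq; apply: (big_ind (fun x => x \in S)) => // x y xS yS.
  by rewrite /minn; case: ifP.
move=> x; rewrite -[x \in S]/(x \in enum_fset S).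
move: (head 0 S) => z; elim: (enum_fset S) => //= a l IH.
rewrite inE big_cons geq_min => /predU1P [-> | /IH ->]; first by rewrite leqnn.
by rewrite orbT.
Qed.

Definition weak_schreier (S : {fset nat}) : bool :=
  (S != fset0) && (#|` S| <= fset_min S).

Definition zeckendorf (k : nat) (S : {fset nat}) : bool :=
  [forall x : S, forall y : S, (x != y) ==> (k <= `|val x - val y|)].

(* The second argument of iota is a length: iota 1 n is 1, ..., n. *)
Definition H (k n : nat) : nat :=
  #|` [fset S in fpowerset [fset x in iota 1 n]
        | [&& zeckendorf k S, n \in S & weak_schreier S]] |.

(* Main.v *)
Require Import Defs.
From mathcomp Require Import all_boot.
From mathcomp Require Import ssrint finmap zify.

(** Call a set counted by [H k n] admissible, and let n > k + 1.  The admissible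
    sets S with min S > |S| are the translates by 1 of the sets counted by
    [H k (n - 1)].  If min S = |S|, deleting the minimum and translating by
    -(k + 1) gives a set counted by [H k (n - (k + 1))]; conversely T is sent to
    (T + (k + 1)) together with the new minimum |T| + 1. *)

Set Implicit Arguments.
Unset Strict Implicit.
Unset Printing Implicit Defensive.

Import IntDist.
Local Open Scope fset_scope.
Local Open Scope nat_scope.

Definition admissible (k n : nat) : {fset {fset nat}} :=
  [fset S in fpowerset [fset x in iota 1 n]
    | [&& zeckendorf k S, n \in S & weak_schreier S]].

(** Ordering each pair removes the absolute difference and leaves linear inequalities. *)
Lemma zeckendorfP (k : nat) (S : {fset nat}) :
  reflect (forall x y, x \in S -> y \in S -> x < y -> k + x <= y) (zeckendorf k S).
Proof.
apply: (iffP forallP) => [zS x y xS yS lt_xy | zS [x xS]].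
  have /forallP /(_ [` yS]) /implyP := zS [` xS].
  rewrite -val_eqE /= => /(_ (negbT (ltn_eqF lt_xy))).
  by rewrite distnEr; lia.
apply/forallP => -[y yS]; apply/implyP; rewrite -val_eqE /= neq_ltn => /orP[] lt_xy.
  by have := zS _ _ xS yS lt_xy; rewrite distnEr; lia.
by have := zS _ _ yS xS lt_xy; rewrite distnEl; lia.
Qed.

(* [lia] identifies atoms syntactically, so it would not see the cardinals of a set
   at the two forms of its carrier as the same number. *)
Ltac fset_lia :=
  intros; change (Choice.sort Datatypes_nat__canonical__choice_Choice) with nat in *; lia.

Lemma weak_schreierP (S : {fset nat}) :
  S != fset0 -> reflect (forall x, x \in S -> #|` S| <= x) (weak_schreier S).
Proof.
move=> S0; rewrite /weak_schreier S0 /=; have [minS le_min] := fset_minP S0.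
apply: (iffP idP) => [leS x xS | ->//].
exact: leq_trans leS (le_min x xS).
Qed.

(** The bound [1 <= x] imposed by [iota 1 n] is recovered from the last clause: [S] contains [n], so
    its cardinal is positive. *)
Lemma admissibleP (k n : nat) (S : {fset nat}) :
  reflect [/\ n \in S, forall x, x \in S -> x <= n,
              forall x y, x \in S -> y \in S -> x < y -> k + x <= y
            & forall x, x \in S -> #|` S| <= x]
          (S \in admissible k n).
Proof.
rewrite !inE /= fpowersetE.
apply: (iffP andP) => [[/fsubsetP leS /and3P[zS nS wS]] | [nS leS zS wS]].
  have S0 : S != fset0 by apply/fset0Pn; exists n.
  split=> //; [|exact/zeckendorfP|exact/(weak_schreierP S0)].
  by move=> x /leS; rewrite !inE /= mem_iota; fset_lia.
have S0 : S != fset0 by apply/fset0Pn; exists n.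
split; last by apply/and3P; split=> //; [exact/zeckendorfP|exact/(weak_schreierP S0)].
apply/fsubsetP => x xS; rewrite !inE /= mem_iota.
rewrite add1n ltnS leS // andbT.
by apply: leq_trans (wS x xS); rewrite cardfs_gt0.
Qed.

Definition shift (c : nat) (S : {fset nat}) : {fset nat} := [fset c + x | x in S].

Lemma in_shift (c x : nat) (S : {fset nat}) : (c + x \in shift c S) = (x \in S).
Proof. exact/mem_imfset/addnI. Qed.

Lemma card_shift (c : nat) (S : {fset nat}) : #|` shift c S| = #|` S|.
Proof. exact/card_imfset/addnI. Qed.

Lemma shift_inj (c : nat) : injective (shift c).
Proof. by move=> S T eqST; apply/fsetP => x; rewrite -(in_shift c) eqST in_shift. Qed.

Lemma shift_ex (c : nat) (S : {fset nat}) :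
  (forall x, x \in S -> c <= x) -> exists T, S = shift c T.
Proof.
move=> leS; exists [fset x - c | x in S]; apply/fsetP => y; apply/idP/idP.
  move=> yS; rewrite -(subnKC (leS y yS)) in_shift.
  by apply/imfsetP; exists y.
by case/imfsetP => _ /imfsetP[x /= xS ->] ->; rewrite subnKC ?leS.
Qed.

(** For admissible [T], the inserted number is the cardinal of the result. Elements of [T] are at
    least |T|, so after translation they are at least k + (|T| + 1), exactly the gap required. *)
Definition add_min (k : nat) (T : {fset nat}) : {fset nat} :=
  #|` T|.+1 |` shift k.+1 T.

Section AddMin.
Variables (k n : nat) (T : {fset nat}).
Hypotheses (k_gt0 : 0 < k) (T_adm : T \in admissible k n).

Lemma add_min_notin : #|` T|.+1 \notin shift k.+1 T.
Proof.
case/admissibleP: T_adm => _ _ _ wT.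
by apply/negP => /imfsetP[x /= /wT]; fset_lia.
Qed.

Lemma card_add_min : #|` add_min k T| = #|` T|.+1.
Proof. by rewrite cardfsU1 add_min_notin card_shift. Qed.

(** The inserted element can be read off as the cardinal of the image; this is what makes [add_min]
    injective on admissible sets. *)
Lemma add_minK : add_min k T `\ #|` add_min k T| = shift k.+1 T.
Proof. by rewrite card_add_min fsetU1K // add_min_notin. Qed.

Lemma add_min_admissible : add_min k T \in admissible k (k.+1 + n).
Proof.
case/admissibleP: (T_adm) => nT leT zT wT.
apply/admissibleP; rewrite card_add_min; split.
- by rewrite !inE in_shift nT orbT.
- move=> x /fset1UP[-> | /imfsetP[y /= /leT ley ->]]; last by fset_lia.
  (* The new minimum stays below the new maximum because |T| <= n. *)
  by have := wT n nT; fset_lia.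
- move=> x y /fset1UP[-> | /imfsetP[x' /= x'T ->]] /fset1UP[-> | /imfsetP[y' /= y'T ->]].
  + by rewrite ltnn.
  + by have := wT y' y'T; fset_lia.
  + by have := wT x' x'T; fset_lia.
  + by have := zT _ _ x'T y'T; fset_lia.
- move=> x /fset1UP[-> // | /imfsetP[y /= /wT ley ->]]; fset_lia.
Qed.

End AddMin.

Lemma add_min_inj (k n : nat) : 0 < k -> {in admissible k n &, injective (add_min k)}.
Proof.
move=> k0 S T Sadm Tadm eqST; apply: (@shift_inj k.+1).
by rewrite -(add_minK k0 Sadm) eqST (add_minK k0 Tadm).
Qed.

(** Translation by 1 keeps gaps and cardinal, so |S| <= x for [S] becomes a strict bound for its
    translate. The boolean equality serves both inclusions of the recurrence by rewriting. *)
Lemma shift1_admissible (k n : nat) (S : {fset nat}) :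
  (shift 1 S \in admissible k n.+1)
    && [forall x : shift 1 S, #|` S| < val x] = (S \in admissible k n).
Proof.
apply/andP/admissibleP => [[/admissibleP[nS leS zS _] /forallP wS] | [nS leS zS wS]].
  split=> [|x xS|x y xS yS lt_xy|x xS].
  - by rewrite -(in_shift 1).
  - by apply: (leS (1 + x)); rewrite in_shift.
  - by have := zS (1 + x) (1 + y); rewrite !in_shift xS yS; fset_lia.
  - have xS1 : 1 + x \in shift 1 S by rewrite in_shift.
    exact: (wS [` xS1]).
split; last by apply/forallP => -[_ /= /imfsetP[x /= /wS lex ->]]; fset_lia.
apply/admissibleP; rewrite card_shift; split.
- by rewrite -add1n in_shift.
- by move=> _ /imfsetP[x /= /leS lex ->]; fset_lia.
- move=> _ _ /imfsetP[x /= xS ->] /imfsetP[y /= yS ->].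
  by have := zS _ _ xS yS; fset_lia.
- by move=> _ /imfsetP[x /= /wS lex ->]; fset_lia.
Qed.

Lemma add_min_ex (k n : nat) (S : {fset nat}) :
  0 < n -> S \in admissible k (k.+1 + n) -> #|` S| \in S ->
  exists2 T, T \in admissible k n & S = add_min k T.
Proof.
move=> n0 /admissibleP[nS leS zS wS] cS.
have gtS x : x \in S `\ #|` S| -> k + #|` S| <= x.
  case/fsetD1P => neq xS; apply: zS => //.
  by rewrite ltn_neqAle eq_sym neq wS.
(* A singleton containing its own cardinal is {1}, which misses k + 1 + n. *)
have S1 : 1 < #|` S|.
  rewrite ltn_neqAle cardfs_gt0; apply/andP; split; last by apply/fset0Pn; exists #|` S|.
  apply/eqP => /esym /eqP /cardfs1P[a eqS].
  move: cS nS; rewrite eqS cardfs1 !inE => /eqP<-; fset_lia.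
have [|T eqT] := @shift_ex k.+1 (S `\ #|` S|).
  by move=> x /gtS; fset_lia.
have cT : #|` S| = #|` T|.+1.
  by rewrite (cardfsD1 #|` S| S) cS eqT card_shift.
have inT x : x \in T -> k.+1 + x \in S.
  by rewrite -(in_shift k.+1 x T) -eqT => /fsetD1P[].
exists T; last by rewrite /add_min -eqT -cT fsetD1K.
apply/admissibleP; split.
- rewrite -(in_shift k.+1) -eqT !inE nS andbT.
  (* The maximum survives the deletion: were it equal to |S|, which is the minimum, [S] would have
     only one element. *)
  apply/eqP => eqn; have Ssub : S `<=` [fset #|` S|].
    apply/fsubsetP => x xS; rewrite inE.
    by rewrite eqn_leq wS // andbT -eqn leS.
  by have := fsubset_leq_card Ssub; rewrite cardfs1; fset_lia.
- by move=> x /inT /leS; fset_lia.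
- by move=> x y /inT xS /inT yS; have := zS _ _ xS yS; fset_lia.
- move=> x; rewrite -(in_shift k.+1) -eqT => /gtS; fset_lia.
Qed.

Lemma admissible_rec (k n : nat) : 0 < k -> 0 < n ->
  admissible k (k.+1 + n) =
    [fset shift 1 S | S in admissible k (k + n)]
    `|` [fset add_min k T | T in admissible k n].
Proof.
move=> k0 n0; apply/fsetP => S; rewrite inE; apply/idP/orP.
  (* As every element is at least |S|, membership of |S| means exactly that the minimum equals
     |S|. *)
  move=> Sadm; have [cS|cS] := boolP (#|` S| \in S).
    right; have [T Tadm ->] := add_min_ex n0 Sadm cS.
    by apply/imfsetP; exists T.
  left; case/admissibleP: (Sadm) => nS leS zS wS.
  have gtS x : x \in S -> #|` S| < x.
    move=> xS; rewrite ltn_neqAle wS // andbT.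
    by apply: contraNneq cS => ->.
  have [|T eqS] := @shift_ex 1 S; first by move=> x /gtS; fset_lia.
  apply/imfsetP; exists T => //=; rewrite -shift1_admissible -eqS Sadm /=.
  by apply/forallP => -[x xS] /=; rewrite -(card_shift 1) -eqS gtS.
case=> /imfsetP[T /= Tadm ->]; last exact: add_min_admissible.
by move: Tadm; rewrite -shift1_admissible => /andP[].
Qed.

(** Images under [add_min] contain their own cardinal, while all elements of the translates by 1
    exceed theirs. *)
Lemma admissible_rec_disjoint (k n : nat) : 0 < k ->
  [disjoint [fset shift 1 S | S in admissible k (k + n)]
          & [fset add_min k T | T in admissible k n]]%fset.
Proof.
move=> k0; apply/fdisjointP => _ /imfsetP[S /= Sadm ->].
apply/imfsetP => -[T /= Tadm eqST].
have : #|` add_min k T| \in add_min k T by rewrite (card_add_min k0 Tadm) fset1U1.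
rewrite -eqST card_shift => /imfsetP[x /= xS].
by case/admissibleP: Sadm => _ _ _ /(_ x xS); fset_lia.
Qed.

Lemma admissible_small (k n : nat) :
  0 < n -> n <= k.+1 -> admissible k n = [fset [fset n]].
Proof.
move=> n0 len; apply/fsetP => S; rewrite in_fset1; apply/admissibleP/eqP.
  case=> nS leS zS wS; apply/fsetP => x; rewrite in_fset1.
  apply/idP/eqP => [xS | -> //]; apply/eqP; apply: contraT => neq.
  have lt_xn : x < n by rewrite ltn_neqAle neq leS.
  (* A second element x < n forces x >= |S| >= 2, hence n >= k + x >= k + 2. *)
  have := zS _ _ xS nS lt_xn; have := wS _ xS.
  have /fsubset_leq_card : [fset x; n] `<=` S.
    by apply/fsubsetP => y /fset2P[] ->.
  rewrite cardfs2 neq; fset_lia.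
move=> ->; split.
- by rewrite in_fset1.
- by move=> x /fset1P->.
- by move=> x y /fset1P-> /fset1P->; rewrite ltnn.
- by move=> x /fset1P->; rewrite cardfs1.
Qed.

Theorem theorem4 (k : nat) (hk : 2 <= k) (n : nat) (hn : 1 <= n) :
  H k n = if n <= k + 1 then 1 else H k (n - 1) + H k (n - (k + 1)).
Proof.
have k0 : 0 < k by exact: ltnW.
rewrite addn1; case: leqP => [len | ltn].
  by rewrite /H -/(admissible k n) admissible_small // cardfs1.
(* With m = n - (k + 1), the three indices become k + 1 + m, k + m and m, free of truncated
   subtraction. *)
have -> : n - 1 = k + (n - k.+1) by fset_lia.
have m0 : 0 < n - k.+1 by fset_lia.
rewrite -{1}(subnKC (ltnW ltn)); move: (n - k.+1) m0 => m m0.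
rewrite /H -!/(admissible _ _) admissible_rec // cardfsU.
rewrite (eqP (admissible_rec_disjoint m k0)) cardfs0 subn0.
by congr (_ + _); [exact/card_imfset/shift_inj | exact/card_in_imfset/add_min_inj].
Qed.
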